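(* Let $q$ be a formal variable (or a complex number with $|q|<1$). For $k\in\{0,1\}$ and every integer $n\geq 0$, \[ \sum_{j=-n-k}^{n}(-1)^j q^{j(5j+1)/2} =\sum_{r=0}^{n} e_{2r+k+2}\,(-1)^{n-r}q^{(n-r)(5n+3r+4k+5)/2}\frac{(q;q)_{n+r+k}}{(q;q)_{n-r}} \] and \[ \sum_{j=-n-k}^{n}(-1)^j q^{j(5j+3)/2} =\sum_{r=0}^{n} d_{2r+k+2}\,(-1)^{n-r}q^{(n-r)(5n+3r+4k+5)/2}\frac{(q;q)_{n+r+k}}{(q;q)_{n-r}}, \] where $e_n,d_n$ are the Schur polynomials described in the context.
   Context: For $n\geq 0$, $(a;q)_n=\prod_{j=0}^{n-1}(1-aq^j)$. The Schur polynomials $(e_n)_{n\geq 1}$ and $(d_n)_{n\geq 1}$ are defined by the recurrence $x_{n+2}=x_{n+1}+q^n x_n$ with initial conditions $e_1=e_2=1$, $d_1=0$, $d_2=1$. Equivalently, for $n\geq 2$, $e_n$ is the generating function $\sum_\lambda q^{|\lambda|}$ of partitions $\lambda$ whose parts differ pairwise by at least $2$ and whose largest part is at most $n-2$, and $d_n$ is the same generating function restricted additionally to partitions having no part equal to $1$. *)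

(* Defs.v *)
From HB Require Import structures.
From mathcomp Require Import all_boot all_order all_algebra.
From mathcomp Require Import fraction complex.
From mathcomp Require Import reals.

Set Implicit Arguments.
Unset Strict Implicit.
Unset Printing Implicit Defensive.

Import Order.TTheory GRing.Theory Num.Theory.
Local Open Scope ring_scope.

Definition qpoch (R : nzRingType) (a q : R) (n : nat) : R :=
  \prod_(j < n) (1 - a * q ^+ j).

(* x_(n+2) = x_(n+1) + q^n x_n for n >= 1, with prescribed x_1 and x_2.
   The sequence is indexed from 1; its value at 0 is a dummy. *)
Fixpoint schur_rec (R : nzRingType) (q x1 x2 : R) (n : nat) : R :=
  match n with
  | 0 => 0
  | m.+1 =>
    match m with
    | 0 => x1
    | p.+1 =>
      match p with
      | 0 => x2
      | _.+1 => schur_rec q x1 x2 m + q ^+ p * schur_rec q x1 x2 p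
      end
    end
  end.

Definition schur_e (R : nzRingType) (q : R) (n : nat) : R := schur_rec q 1 1 n.
Definition schur_d (R : nzRingType) (q : R) (n : nat) : R := schur_rec q 0 1 n.

Lemma schur_recE (R : nzRingType) (q x1 x2 : R) (n : nat) : (0 < n)%N ->
  schur_rec q x1 x2 n.+2 =
    schur_rec q x1 x2 n.+1 + q ^+ n * schur_rec q x1 x2 n.
Proof. by case: n. Qed.

(* The integers a, a + 1, ..., b in increasing order (empty if b < a). *)
Definition int_range (a b : int) : seq int :=
  [seq a + i%:Z | i <- iota 0 (if a <= b then `|b - a|%N.+1 else 0%N)].

Lemma int_range_uniq (a b : int) : uniq (int_range a b).
Proof. by rewrite map_inj_uniq ?iota_uniq // => i j /addrI; case. Qed.

Lemma mem_int_range (a b j : int) : (j \in int_range a b) = (a <= j <= b).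
Proof.
apply/mapP/idP => [[m]|/andP[aj jb]].
  rewrite mem_iota add0n; case: ifP => // ab /= ilt ->.
  by rewrite lerDl lez_nat leq0n /= addrC -lerBrDr -[b - a]gez0_abs ?subr_ge0.
exists `|j - a|%N; last by rewrite gez0_abs ?subr_ge0 // addrCA subrr addr0.
rewrite mem_iota add0n (le_trans aj jb) /= ltnS -lez_nat.
by rewrite !gez0_abs ?subr_ge0 ?(le_trans aj jb) // lerD2r.
Qed.

(* Main.v *)
Require Import Defs.
From HB Require Import structures.
From mathcomp Require Import all_boot all_order all_algebra.
From mathcomp Require Import fraction complex.
From mathcomp Require Import reals.
From mathcomp Require Import zify ring.

Set Implicit Arguments.
Unset Strict Implicit.
Unset Printing Implicit Defensive.

Import Order.TTheory GRing.Theory Num.Theory.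
Local Open Scope ring_scope.

(* Write c(m,s) = (-1)^s q^(2ms + 5s(s+1)/2) (q;q)_(m+s) / (q;q)_s.  With
   m = 2r + k, s = n - r and N = 2n + k = m + 2s, the right-hand side is
   F(N) = sum_(m + 2s = N) x_(m+2) c(m,s) for a solution x of Schur's
   recurrence.  The difference F(N) - F(N-1), with the terms (m,s) and (m-1,s) paired,
   telescopes: its partial sums are
   - c(m-1,s) q^(m+s) (x_(m+1) - (1 - q^(m+s)) x_m).
   At the end of the range only a monomial is left for x = e and for x = d,
   and it is the term by which the left-hand side grows from N-1 to N. *)

(** * Integer ranges enlarged by one endpoint *)

Lemma int_range_rcons (m n : nat) :
  int_range (- m%:Z) n.+1%:Z = rcons (int_range (- m%:Z) n%:Z) n.+1%:Z.
Proof.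
have range_le i j : - i%:Z <= j%:Z :> int by lia.
rewrite /int_range !range_le.
have -> : `|n.+1%:Z - - m%:Z|%N.+1 = (m + n).+2 by lia.
have -> : `|n%:Z - - m%:Z|%N.+1 = (m + n).+1 by lia.
rewrite -[(m + n).+2]addn1 iotaD map_cat cats1 add0n.
by congr (rcons _ _); lia.
Qed.

Lemma int_range_cons (m n : nat) :
  int_range (- m.+1%:Z) n%:Z = - m.+1%:Z :: int_range (- m%:Z) n%:Z.
Proof.
have range_le i j : - i%:Z <= j%:Z :> int by lia.
rewrite /int_range !range_le.
have -> : `|n%:Z - - m.+1%:Z|%N.+1 = (m + n).+2 by lia.
have -> : `|n%:Z - - m%:Z|%N.+1 = (m + n).+1 by lia.
rewrite -[(m + n).+2]add1n iotaD add0n map_cat (iotaDl 1 0) -map_comp -cat1s.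
congr (_ ++ _); first by rewrite /= addr0.
by apply: eq_map => i /=; lia.
Qed.

(** * Telescoping of the weighted sums, over any commutative ring *)

Section SchurSums.

Variables (R : comNzRingType) (q : R).

(* The quotient (q;q)_(m+s) / (q;q)_s is the polynomial (q^(s+1);q)_m. *)
Definition schur_weight (m s : nat) : R :=
  (-1) ^+ s * q ^+ (2 * m * s + 5 * 'C(s.+1, 2)) * qpoch (q ^+ s.+1) q m.

Lemma schur_weightSl (m s : nat) :
  schur_weight m.+1 s
  = schur_weight m s * (q ^+ s) ^+ 2 * (1 - q ^+ (m + s).+1).
Proof.
rewrite /schur_weight /qpoch big_ord_recr /= -exprD.
have -> : (s.+1 + m = (m + s).+1)%N by lia.
have -> : (2 * m.+1 * s + 5 * 'C(s.+1, 2)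
           = 2 * m * s + 5 * 'C(s.+1, 2) + s * 2)%N by lia.
by rewrite [q ^+ (_ + s * 2)]exprD -exprM; ring.
Qed.

(** The factor [1 - q ^+ s.+1] extends (q^(s+2);q)_m to (q^(s+1);q)_(m+1); keeping it on the left
    avoids a division. *)
Lemma schur_weightSr (m s : nat) :
  schur_weight m s.+1 * (1 - q ^+ s.+1)
  = - schur_weight m.+1 s * q ^+ (2 * m + 3 * s + 5).
Proof.
rewrite /schur_weight /qpoch big_ord_recl /= expr0 mulr1.
under eq_bigr => j _ do rewrite -exprD.
under [in RHS]eq_bigr => j _ do rewrite -exprD.
under eq_bigr => j _ do rewrite addSnnS.
rewrite exprS.
have -> : (2 * m * s.+1 + 5 * 'C(s.+2, 2)
           = 2 * m.+1 * s + 5 * 'C(s.+1, 2) + (2 * m + 3 * s + 5))%N.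
  by rewrite binS bin1; lia.
by rewrite exprD /bump /=; ring.
Qed.

Lemma schur_weight0 (s : nat) :
  schur_weight 0 s = (-1) ^+ s * q ^+ (5 * 'C(s.+1, 2)).
Proof. by rewrite /schur_weight /qpoch big_ord0 mulr1 muln0. Qed.

Variables (x1 x2 : R).
Let x := schur_rec q x1 x2.

(** This is F(2n + k), cut off at s = n. All [k] are allowed, since the induction below moves
    [k]. *)
Definition schur_sum (k n : nat) : R :=
  \sum_(s < n.+1) x (2 * (n - s) + k + 2) * schur_weight (2 * (n - s) + k) s.

Lemma schur_sumS (k n : nat) :
  schur_sum k n.+1 = schur_sum k.+2 n + x k.+2 * schur_weight k n.+1.
Proof.
rewrite /schur_sum big_ord_recr /= subnn add0n addn2; congr (_ + _).
apply: eq_bigr => s _; have := ltn_ord s => lts.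
by congr (x _ * schur_weight _ _); lia.
Qed.

(** Removing the pair with s = n + 1 from both sums leaves the same difference at [k.+2], so the
    induction on [n] must hold for all [k]. *)
Lemma schur_sum_diff (k n : nat) :
  schur_sum k.+1 n - schur_sum k n =
  - schur_weight k n * q ^+ (k + n).+1
    * (x k.+2 - (1 - q ^+ (k + n).+1) * x k.+1).
Proof.
elim: n k => [|n IHn] k.
  rewrite /schur_sum !big_ord1 subnn !add0n !addn2 schur_weightSl addn0.
  by rewrite /x schur_recE //; ring.
have -> : schur_sum k.+1 n.+1 - schur_sum k n.+1
   = (schur_sum k.+3 n - schur_sum k.+2 n)
     + x k.+3 * schur_weight k.+1 n.+1 - x k.+2 * schur_weight k n.+1.
  by rewrite !schur_sumS; ring.
rewrite IHn (schur_weightSl k n.+1).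
(* The recurrence for [x k.+4] frees a factor q^(k+2); the exponent becomes the one in
   [schur_weightSr], which then yields [schur_weight k n.+1]. *)
have -> : - schur_weight k.+2 n * q ^+ (k.+2 + n).+1
          * (x k.+4 - (1 - q ^+ (k.+2 + n).+1) * x k.+3)
        = - schur_weight k.+1 n * q ^+ (2 * k + 3 * n + 5)
          * (1 - q ^+ (k + n.+1).+1) * (x k.+2 + q ^+ n.+1 * x k.+3).
  rewrite schur_weightSl {1}/x schur_recE // -/x.
  have -> : (2 * k + 3 * n + 5 = n + n + (k.+2 + n).+1 + k.+2)%N by lia.
  have -> : (k.+1 + n).+1 = (k + n.+1).+1 by lia.
  have e3 : ((k.+2 + n).+1 = k.+2 + n.+1)%N by lia.
  rewrite {2}e3 !exprD; ring.
have -> : x k.+3 = x k.+2 + q ^+ k.+1 * x k.+1 by rewrite /x schur_recE.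
rewrite -schur_weightSr.
have -> : (k + n.+1).+1 = (k.+1 + n.+1)%N by lia.
rewrite !exprD; ring.
Qed.

(** With Q = q^(n+1), the last factor is Q^2 for e and Q for d. *)
Lemma schur_sum1_diff (n : nat) :
  schur_sum 1 n - schur_sum 0 n
  = (-1) ^+ n.+1 * q ^+ (5 * 'C(n.+1, 2))
    * (q ^+ n.+1 * (x2 - (1 - q ^+ n.+1) * x1)).
Proof.
by rewrite schur_sum_diff schur_weight0 add0n [(-1) ^+ n.+1]exprS /x /=; ring.
Qed.

(** The term m = 0, s = n + 1 has no partner and gives the summand [x2 * q ^+ (5 * n.+1)]. With Q =
    q^(n+1), it cancels the -Q^5 of the product: Q^3 is left for e and Q^4 for d. *)
Lemma schur_sum0_diff (n : nat) :
  schur_sum 0 n.+1 - schur_sum 1 n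
  = (-1) ^+ n.+1 * q ^+ (5 * 'C(n.+1, 2))
    * (q ^+ (3 * n.+1) * (1 - q ^+ n.+1) * (x1 + q ^+ n.+1 * x2)
       + x2 * q ^+ (5 * n.+1)).
Proof.
rewrite schur_sumS addrAC schur_sum_diff schur_weightSl !schur_weight0 add0n.
have -> : x 3 = x2 + q * x1 by rewrite /x schur_recE // expr1.
have -> : x 2 = x2 by [].
have -> : (5 * 'C(n.+2, 2) = 5 * 'C(n.+1, 2) + n.+1 * 5)%N.
  by rewrite binS bin1; lia.
rewrite [q ^+ (_ + n.+1 * 5)]exprD !(mulnC _ n.+1) !(exprM _ n.+1).
rewrite add1n [q ^+ n.+2]exprS ![_ ^+ n.+1]exprS; ring.
Qed.

(** The indices enter in the order 0, -1, 1, -2, 2, ..., each raising N = 2n + k by one. *)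
Lemma schur_sum_int_range (t : int -> R) (k n : nat) :
    k = 0%N \/ k = 1%N -> t 0 = x2 ->
    (forall m, t (- m.+1%:Z) = schur_sum 1 m - schur_sum 0 m) ->
    (forall m, t m.+1%:Z = schur_sum 0 m.+1 - schur_sum 1 m) ->
  \sum_(j <- int_range (- (n + k)%N%:Z) n%:Z) t j = schur_sum k n.
Proof.
move=> hk t0 tneg tpos.
have step m :
    \sum_(j <- int_range (- m%:Z) m%:Z) t j = schur_sum 0 m ->
    \sum_(j <- int_range (- m.+1%:Z) m%:Z) t j = schur_sum 1 m.
  by rewrite int_range_cons big_cons tneg => ->; rewrite subrK.
have base m : \sum_(j <- int_range (- m%:Z) m%:Z) t j = schur_sum 0 m.
  elim: m => [|m IHm].
    by rewrite /schur_sum big_ord1 big_seq1 schur_weight0 /x /= t0 !mulr1.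
  by rewrite int_range_rcons big_rcons /= step // tpos addrC subrK.
by case: hk => ->; rewrite ?addn0 ?addn1 //; apply: step.
Qed.

End SchurSums.

(** * Return to quotients and halved exponents, over a field *)

Lemma qpoch_cat (R : nzRingType) (a q : R) (m n : nat) :
  qpoch a q (m + n) = qpoch a q m * qpoch (a * q ^+ m) q n.
Proof.
rewrite /qpoch big_split_ord /=; congr (_ * _).
by apply: eq_bigr => j _; rewrite exprD mulrA.
Qed.

Lemma signr_intz (F : fieldType) (j : int) : (-1) ^ j = (-1) ^+ `|j|%N :> F.
Proof. by case: j => n //=; rewrite NegzE -exprnN -exprVn invrN1. Qed.

Lemma mul_bin2 (m : nat) : (2 * 'C(m.+1, 2) = m * m.+1)%N.
Proof. by rewrite -mul_bin_diag bin1 mulnC. Qed.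

Section RootOfUnityFree.

Variables (F : fieldType) (q : F).
Hypothesis q_neq1 : forall i : nat, q ^+ i.+1 != 1.

Lemma schur_sumE (x1 x2 : F) (k n : nat) :
  \sum_(0 <= r < n.+1)
      schur_rec q x1 x2 (2 * r + k + 2) * (-1) ^+ (n - r)
        * q ^+ ((n - r) * (5 * n + 3 * r + 4 * k + 5) %/ 2)
        * (qpoch q q (n + r + k) / qpoch q q (n - r))
  = schur_sum q x1 x2 k n.
Proof.
rewrite big_mkord /schur_sum (reindex_inj rev_ord_inj) /=.
apply: eq_bigr => s _; have := ltn_ord s => lts; rewrite subSS.
set r := (n - s)%N; have -> : (n - r)%N = s by lia.
have -> : (n + r + k = s + (2 * r + k))%N by lia.
(* Cancelling (q;q)_s requires that no q^i with 1 <= i <= s equals 1. *)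
rewrite qpoch_cat -exprS [qpoch q q s * _]mulrC mulfK; last first.
  apply/prodf_neq0 => j _; rewrite -exprS subr_eq0 eq_sym; exact: q_neq1.
have -> : (s * (5 * n + 3 * r + 4 * k + 5) %/ 2
           = 2 * (2 * r + k) * s + 5 * 'C(s.+1, 2))%N.
  (* Writing the right side as its double over 2 leaves an equality of numerators. *)
  rewrite -[RHS](@mulnK _ 2) //; congr divn.
  by have := mul_bin2 s; nia.
by rewrite /schur_weight !mulrA.
Qed.

Lemma schur_e_identity (k n : nat) : k = 0%N \/ k = 1%N ->
  \sum_(j <- int_range (- (n + k)%N%:Z) n%:Z)
      (-1) ^ j * q ^ (j * (5 * j + 1) %/ 2)%Z
  = \sum_(0 <= r < n.+1)
      schur_e q (2 * r + k + 2) * (-1) ^+ (n - r)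
        * q ^+ ((n - r) * (5 * n + 3 * r + 4 * k + 5) %/ 2)
        * (qpoch q q (n + r + k) / qpoch q q (n - r)).
Proof.
move=> hk; rewrite schur_sumE.
apply: schur_sum_int_range => // [|m|m]; rewrite signr_intz.
  by rewrite mul0r div0z expr0z mulr1.
  have -> : (- m.+1%:Z * (5 * - m.+1%:Z + 1) %/ 2)%Z
            = (5 * 'C(m.+1, 2) + 2 * m.+1)%N%:Z.
    by rewrite -[RHS](@mulzK _ 2) //; congr divz; have := mul_bin2 m; nia.
  rewrite schur_sum1_diff abszN absz_nat -exprnP exprD (mulnC 2%N).
  rewrite (exprM _ m.+1); ring.
have -> : (m.+1%:Z * (5 * m.+1%:Z + 1) %/ 2)%Z
          = (5 * 'C(m.+1, 2) + 3 * m.+1)%N%:Z.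
  by rewrite -[RHS](@mulzK _ 2) //; congr divz; have := mul_bin2 m; nia.
rewrite schur_sum0_diff absz_nat -exprnP exprD !(mulnC _ m.+1)
        !(exprM _ m.+1); ring.
Qed.

Lemma schur_d_identity (k n : nat) : k = 0%N \/ k = 1%N ->
  \sum_(j <- int_range (- (n + k)%N%:Z) n%:Z)
      (-1) ^ j * q ^ (j * (5 * j + 3) %/ 2)%Z
  = \sum_(0 <= r < n.+1)
      schur_d q (2 * r + k + 2) * (-1) ^+ (n - r)
        * q ^+ ((n - r) * (5 * n + 3 * r + 4 * k + 5) %/ 2)
        * (qpoch q q (n + r + k) / qpoch q q (n - r)).
Proof.
move=> hk; rewrite schur_sumE.
apply: schur_sum_int_range => // [|m|m]; rewrite signr_intz.
  by rewrite mul0r div0z expr0z mulr1.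
  have -> : (- m.+1%:Z * (5 * - m.+1%:Z + 3) %/ 2)%Z
            = (5 * 'C(m.+1, 2) + m.+1)%N%:Z.
    by rewrite -[RHS](@mulzK _ 2) //; congr divz; have := mul_bin2 m; nia.
  rewrite schur_sum1_diff abszN absz_nat -exprnP exprD; ring.
have -> : (m.+1%:Z * (5 * m.+1%:Z + 3) %/ 2)%Z
          = (5 * 'C(m.+1, 2) + 4 * m.+1)%N%:Z.
  by rewrite -[RHS](@mulzK _ 2) //; congr divz; have := mul_bin2 m; nia.
rewrite schur_sum0_diff absz_nat -exprnP exprD !(mulnC _ m.+1)
        !(exprM _ m.+1); ring.
Qed.

End RootOfUnityFree.

(* First conjunct: q is the formal variable, in the field of fractions of Z[q].
   Second conjunct: q is a complex number with |q| < 1. *)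
Theorem theorem1p1 (k n : nat) (hk : k = 0%N \/ k = 1%N) :
  (let q : {fraction {poly int}} := FracField.tofrac 'X in
   \sum_(j <- int_range (- (n + k)%N%:Z) n%:Z)
      (-1) ^ j * q ^ (j * (5 * j + 1) %/ 2)%Z
   = \sum_(0 <= r < n.+1)
      schur_e q (2 * r + k + 2) * (-1) ^+ (n - r)
        * q ^+ ((n - r) * (5 * n + 3 * r + 4 * k + 5) %/ 2)
        * (qpoch q q (n + r + k) / qpoch q q (n - r))
   /\
   \sum_(j <- int_range (- (n + k)%N%:Z) n%:Z)
      (-1) ^ j * q ^ (j * (5 * j + 3) %/ 2)%Z
   = \sum_(0 <= r < n.+1)
      schur_d q (2 * r + k + 2) * (-1) ^+ (n - r)
        * q ^+ ((n - r) * (5 * n + 3 * r + 4 * k + 5) %/ 2)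
        * (qpoch q q (n + r + k) / qpoch q q (n - r)))
  /\
  (forall (R : realType) (q : R[i]), `|q| < 1 ->
   \sum_(j <- int_range (- (n + k)%N%:Z) n%:Z)
      (-1) ^ j * q ^ (j * (5 * j + 1) %/ 2)%Z
   = \sum_(0 <= r < n.+1)
      schur_e q (2 * r + k + 2) * (-1) ^+ (n - r)
        * q ^+ ((n - r) * (5 * n + 3 * r + 4 * k + 5) %/ 2)
        * (qpoch q q (n + r + k) / qpoch q q (n - r))
   /\
   \sum_(j <- int_range (- (n + k)%N%:Z) n%:Z)
      (-1) ^ j * q ^ (j * (5 * j + 3) %/ 2)%Z
   = \sum_(0 <= r < n.+1)
      schur_d q (2 * r + k + 2) * (-1) ^+ (n - r)
        * q ^+ ((n - r) * (5 * n + 3 * r + 4 * k + 5) %/ 2)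
        * (qpoch q q (n + r + k) / qpoch q q (n - r))).
Proof.
split=> [q|R q q_lt1].
  have q_neq1 i : q ^+ i.+1 != 1.
    (* In Z[X], the polynomials X^(i+1) and 1 have different sizes, i + 2 and 1. *)
    rewrite -rmorphXn -tofrac1 tofrac_eq; apply/eqP => /(congr1 (size \o val)).
    by rewrite /= size_polyXn size_poly1.
  by split; [apply: schur_e_identity | apply: schur_d_identity].
have q_neq1 i : q ^+ i.+1 != 1.
  apply/eqP => qi; have := exprn_ilt1 i.+1 (normr_ge0 q) q_lt1.
  by rewrite -normrX qi normr1 ltxx.
by split; [apply: schur_e_identity | apply: schur_d_identity].
Qed.
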